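(* Let $k\geq 1$ and $n\geq 6k^3$ be integers. If $G$ is a connected graph with $n$ vertices, at most $n\left(1+\frac{1}{24k-12}\right)$ edges and $\alpha'(G)=\alpha'$, then $$\max\{n,\,n+k-1-\alpha'-\beta\}\leq r(G,K_{1,k})\leq \max\{n,\,n+k-1-\alpha'\},$$ where $\beta=0$ if $k \mid n+k-2-\alpha'$, and $\beta=1$ otherwise.
   Context: All graphs are finite and simple. For a graph $G$ and a vertex $v\in V(G)$, $N(v)$ is the set of neighbours of $v$, $N[v]=N(v)\cup\{v\}$, and $G_v=G-N[v]$ is the graph obtained from $G$ by deleting all vertices of $N[v]$. The independence number $\alpha(H)$ of a graph $H$ is the maximum size of an independent set (so it is $0$ if $H$ has no vertices). Define $\alpha'(G)=\min\{\alpha(G_v): v\in V(G)\}$. $K_{1,k}$ is the star on $k+1$ vertices. For graphs $G,H$, the Ramsey number $r(G,H)$ is the smallest positive integer $N$ such that for every graph $F$ on $N$ vertices, either $G$ is a (not necessarily induced) subgraph of $F$ or $H$ is a (not necessarily induced) subgraph of the complement $\overline{F}$; equivalently, every red-blue edge-coloring of $K_N$ contains a red copy of $G$ or a blue copy of $H$. *)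

(* Defs.v *)
From HB Require Import structures.
From mathcomp Require Import all_boot all_order all_algebra.
Set Implicit Arguments.
Unset Strict Implicit.
Unset Printing Implicit Defensive.

Record sgraph (V : finType) := SGraph {
  adj :> rel V;
  adj_sym : symmetric adj;
  adj_irr : irreflexive adj
}.

Definition edges (V : finType) (G : sgraph V) : {set {set V}} :=
  [set e : {set V} | [exists x, exists y, G x y && (e == [set x; y])]].

Definition connected (V : finType) (G : sgraph V) : Prop :=
  0 < #|V| /\ forall x y : V, connect G x y.

Definition cnbh (V : finType) (G : sgraph V) (v : V) : {set V} :=
  v |: [set x | G v x].

Section Induced.
Variables (V : finType) (G : sgraph V) (S : {set V}).

Definition induced_rel : rel {x : V | x \in S} := fun x y => G (val x) (val y).

Lemma induced_sym : symmetric induced_rel.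
Proof. by move=> x y; apply: adj_sym. Qed.

Lemma induced_irr : irreflexive induced_rel.
Proof. by move=> x; apply: adj_irr. Qed.

Definition induced : sgraph {x : V | x \in S} := SGraph induced_sym induced_irr.
End Induced.

Section Complement.
Variables (V : finType) (G : sgraph V).

Definition compl_rel : rel V := fun x y => (x != y) && ~~ G x y.

Lemma compl_sym : symmetric compl_rel.
Proof. by move=> x y; rewrite /compl_rel eq_sym adj_sym. Qed.

Lemma compl_irr : irreflexive compl_rel.
Proof. by move=> x; rewrite /compl_rel eqxx. Qed.

Definition compl : sgraph V := SGraph compl_sym compl_irr.
End Complement.

Section Star.
Variable k : nat.

(* K_{1,k} with centre [ord0]: two vertices are adjacent iff exactly one of
   them is the centre. *)
Definition star_rel : rel 'I_k.+1 := fun x y => (x == ord0) (+) (y == ord0).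

Lemma star_sym : symmetric star_rel.
Proof. by move=> x y; apply: addbC. Qed.

Lemma star_irr : irreflexive star_rel.
Proof. by move=> x; apply: addbb. Qed.

Definition star : sgraph 'I_k.+1 := SGraph star_sym star_irr.
End Star.

Definition independent (V : finType) (G : sgraph V) (S : {set V}) : bool :=
  [forall x in S, forall y in S, ~~ G x y].

Definition indep_num (V : finType) (G : sgraph V) : nat :=
  \max_(S : {set V} | independent G S) #|S|.

Definition del_cnbh (V : finType) (G : sgraph V) (v : V) :=
  induced G (~: cnbh G v).

(* The default [#|V|] bounds every [indep_num (del_cnbh G v)] from above, so it
   does not affect the minimum when [V] is nonempty. *)
Definition min_indep_num_del (V : finType) (G : sgraph V) : nat :=
  \big[minn/#|V|]_(v : V) indep_num (del_cnbh G v).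

Definition subgraph (V W : finType) (G : sgraph V) (F : sgraph W) : Prop :=
  exists2 f : V -> W, injective f & forall x y, G x y -> F (f x) (f y).

Definition ramsey_prop (V W : finType) (G : sgraph V) (H : sgraph W)
    (N : nat) : Prop :=
  forall F : sgraph 'I_N, subgraph G F \/ subgraph H (compl F).

Definition is_ramsey_number (V W : finType) (G : sgraph V) (H : sgraph W)
    (r : nat) : Prop :=
  [/\ 0 < r, ramsey_prop G H r &
      forall N, 0 < N -> ramsey_prop G H N -> r <= N].

Lemma is_ramsey_number_uniq (V W : finType) (G : sgraph V) (H : sgraph W)
    (r s : nat) :
  is_ramsey_number G H r -> is_ramsey_number G H s -> r = s.
Proof.
move=> [r0 rP rmin] [s0 sP smin].
by apply/eqP; rewrite eqn_leq rmin // smin.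
Qed.

(* Main.v *)
Require Import Defs.
From Stdlib Require Import Classical.
From mathcomp Require Import all_boot all_order all_algebra.
From mathcomp Require Import perm zify.
Set Implicit Arguments.
Unset Strict Implicit.
Unset Printing Implicit Defensive.

(** Lower bound.  A complete red graph on n - 1 vertices contains no copy of G
    and has no blue edge.  When this is beaten, take as red graph a complete
    multipartite graph on M vertices, namely the residue classes modulo some q:
    blue is a disjoint union of cliques of order at most k, so there is no blue
    K_{1,k}.  If G were a red subgraph, put v with alpha(G_v) = alpha' in a part
    of order at least l; at most M - n vertices of that part are unused, and
    the used ones other than v form an independent set of G_v, so that
    l - (M - n) - 1 <= alpha'.  This is false for l = k and
    M = n + k - 2 - alpha', but parts of order k only require that k divides M.
    With one vertex less it is false already for l = k - 1, and parts of orders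
    k - 1 and k always exist because M is large.  This is where beta comes from
    ([multipartite_no_ramsey], [ramsey_lower]).

    Upper bound.  Let B be the blue graph, on N >= n vertices, with maximum
    degree at most k - 1; G has to be placed so that no edge of G lies on an
    edge of B.  A vertex of degree less than n / 2k is harmless: as in the
    packing theorem of Sauer and Spencer, any conflict at such a vertex can be
    removed by exchanging its place with a suitable other one
    ([swap_conflicts], [embedding_of_pinned]).  So let H be the set of the t
    vertices of degree at least n / 2k; counting edges gives t = O(k).  Put H
    on positions whose closed blue neighbourhoods are pairwise disjoint
    ([spread_set]), and never move it again.  The at most t(k - 1) blue
    neighbours of these positions must be left empty, or be occupied by
    vertices not adjacent to the corresponding h in H.  If those occupants are
    chosen from one independent set J, no conflict arises among the vertices
    pinned so far, and the exchange argument completes the placement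
    ([embedding_of_fillers]).

    It remains to find J.  If t = 1, say H = {v}, a maximum independent set of
    G_v has at least alpha' elements, and N - n >= k - 1 - alpha' positions
    may be left empty.  Otherwise J is the set of leaves: since
    sum (deg - 2) = 2(e - n), each further vertex of large degree forces about
    n / 2k leaves, while 2(e - n) is at most about n / 12k; so even after the
    neighbours of one h in H are discarded, t(k - 1) leaves remain
    ([card_leaves], [leaf_supply_bound]). *)

(** * Degrees, leaves and independent sets *)

Definition nbh (V : finType) (G : sgraph V) (x : V) : {set V} := [set y | G x y].

Lemma card_bigcup_le (I T : finType) (A : {set I}) (F : I -> {set T}) m :
  (forall i, i \in A -> #|F i| <= m) -> #|\bigcup_(i in A) F i| <= #|A| * m.
Proof.
move=> hF; rewrite -sum_nat_const.
apply: (@leq_trans (\sum_(i in A) #|F i|)); last exact: leq_sum.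
elim/big_rec2: _ => [|i p q _ le_pq]; first by rewrite cards0.
exact: leq_trans (leq_card_setU _ _) (leq_add _ _).
Qed.

Lemma independentP (V : finType) (G : sgraph V) (S : {set V}) :
  reflect {in S &, forall x y, ~~ G x y} (independent G S).
Proof.
apply: (iffP forall_inP) => [hS x y xS yS|hS x xS]; first exact: (forall_inP (hS x xS)).
by apply/forall_inP => y yS; apply: hS.
Qed.

(** Handshake: the neighbours of x correspond to the edges through x, and each
    edge is counted at its two ends. *)
Lemma sum_deg (V : finType) (G : sgraph V) : \sum_x #|nbh G x| = 2 * #|edges G|.
Proof.
have degE x : #|nbh G x| = \sum_(e in edges G) (x \in e).
  transitivity #|[set e in edges G | x \in e]|; last first.
    by rewrite -sum1dep_card big_mkcondr.
  rewrite -(@card_in_imset _ _ (fun y => [set x; y]) (nbh G x)).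
    apply: eq_card => e; rewrite [in RHS]inE.
    apply/imsetP/andP => [[y]|[]]; rewrite inE.
      move=> xy ->; rewrite !inE eqxx; split=> //.
      by apply/existsP; exists x; apply/existsP; exists y; rewrite xy eqxx.
    case/existsP=> u /existsP[v /andP[uv /eqP->]]; rewrite !inE => /orP[]/eqP ->.
      by exists v; rewrite // inE.
    by exists u; rewrite ?inE 1?adj_sym // setUC.
  move=> y z; rewrite !inE => xy _ e.
  have : y \in [set x; z] by rewrite -e !inE eqxx orbT.
  by rewrite !inE => /orP[/eqP yx|/eqP//]; rewrite yx adj_irr in xy.
rewrite (eq_bigr _ (fun x _ => degE x)) exchange_big /=.
rewrite mulnC -sum_nat_const; apply: eq_bigr => e.
rewrite inE => /existsP[x /existsP[y /andP[xy /eqP->]]].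
have <- : #|[set x; y]| = 2.
  by rewrite cards2 (_ : x != y) //; apply: contraTneq xy => ->; rewrite adj_irr.
by rewrite -sum1_card [RHS]big_mkcond.
Qed.

(** Stated as an inequality of cardinals, because it is used to contradict the
    size of [V]: a connected graph has no small union of components. *)
Lemma connected_closed (V : finType) (G : sgraph V) (S : {set V}) (x : V) :
    connected G -> x \in S -> (forall y z, y \in S -> G y z -> z \in S) ->
  #|V| <= #|S|.
Proof.
move=> [_ cG] xS hS; rewrite -cardsT; apply/subset_leq_card/subsetP => y _.
have clS : closed G (mem S).
  by move=> u v uv; apply/idP/idP => ?; [apply: (hS u)|apply: (hS v); rewrite // adj_sym].
by rewrite -(closed_connect clS (cG x y)).
Qed.

Lemma connected_deg_gt0 (V : finType) (G : sgraph V) x :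
  connected G -> 1 < #|V| -> 0 < #|nbh G x|.
Proof.
move=> cG; rewrite card_gt0; apply: contraTneq => x0; rewrite -leqNgt -(cards1 x).
apply: (connected_closed cG (set11 x)) => y z /set1P -> xz.
by have := in_set0 z; rewrite -x0 !inE xz.
Qed.

Definition leaves (V : finType) (G : sgraph V) : {set V} :=
  [set x | #|nbh G x| == 1].

(** Two adjacent leaves would form a component by themselves. *)
Lemma independent_leaves (V : finType) (G : sgraph V) :
  connected G -> 2 < #|V| -> independent G (leaves G).
Proof.
move=> cG V3; apply/independentP => x y; rewrite !inE => /cards1P[x' Nx] /cards1P[y' Ny].
apply: contraTN V3 => xy; rewrite -leqNgt.
have xx' : y = x' by apply/set1P; rewrite -Nx inE.
have yy' : x = y' by apply/set1P; rewrite -Ny inE adj_sym.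
subst x' y'; apply: (@leq_trans #|[set x; y]|); last by rewrite cards2; case: (x != y).
apply: (connected_closed cG (set21 x y)) => u v /set2P[]-> uv; apply/set2P; [right|left].
  by apply/set1P; rewrite -Nx inE.
by apply/set1P; rewrite -Ny inE.
Qed.

(** This is sum (deg - 2) = 2 (e - n), where only leaves contribute negatively,
    truncated to [H] and to the leaves.  Connectedness excludes isolated
    vertices. *)
Lemma card_leaves (V : finType) (G : sgraph V) (H : {set V}) :
    connected G -> 1 < #|V| -> {in H, forall h, 1 < #|nbh G h|} ->
  \sum_(h in H) #|nbh G h| + 2 * #|V| <= 2 * #|edges G| + #|leaves G| + 2 * #|H|.
Proof.
move=> cG V2 hH; rewrite -sum_deg big_mkcond /= !(mulnC 2) -!sum_nat_const.
rewrite -[#|leaves G|]sum1_card [\sum_(x in leaves G) 1]big_mkcond.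
rewrite [\sum_(x in H) 2]big_mkcond /= -!big_split /=; apply: leq_sum => x _.
have := connected_deg_gt0 x cG V2; rewrite inE; have := hH x.
case: (x \in H) => [/(_ isT)|_]; case: eqP; lia.
Qed.

Lemma leq_indep_num_del (V : finType) (G : sgraph V) v (J : {set V}) :
  J \subset ~: cnbh G v -> independent G J -> #|J| <= indep_num (del_cnbh G v).
Proof.
move=> sJ /independentP Jind.
pose J' := [set x : {x | x \in ~: cnbh G v} | val x \in J].
have -> : #|J| = #|J'|.
  rewrite -(card_imset _ val_inj); apply: eq_card => x; apply/idP/imsetP => [xJ|[y]].
    by exists (Sub x (subsetP sJ x xJ)); rewrite ?inE.
  by rewrite inE => ? ->.
apply: (@leq_bigmax_cond _ _ (fun S : {set _} => #|S|) J').
by apply/independentP => x y; rewrite !inE; apply: Jind.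
Qed.

Lemma indep_num_del_witness (V : finType) (G : sgraph V) v :
  exists J : {set V},
    [/\ J \subset ~: cnbh G v, independent G J & #|J| = indep_num (del_cnbh G v)].
Proof.
have [|S Sind maxS] := @eq_bigmax_cond _ (independent (del_cnbh G v)) (fun S : {set _} => #|S|).
  apply/card_gt0P; exists set0; apply/independentP => x y; by rewrite inE.
exists (val @: S); split; last by rewrite card_imset; [exact: esym maxS|exact: val_inj].
  by apply/subsetP => _ /imsetP[x _ ->]; apply: valP.
apply/independentP => _ _ /imsetP[x xS ->] /imsetP[y yS ->].
exact: (independentP _ _ Sind x y xS yS).
Qed.

Lemma min_indep_num_del_le (V : finType) (G : sgraph V) v :
  min_indep_num_del G <= indep_num (del_cnbh G v).
Proof.
rewrite /min_indep_num_del; elim: (index_enum V) (mem_index_enum v) => // u s IHs.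
rewrite inE big_cons geq_min => /orP[/eqP->|/IHs->]; by rewrite ?leqnn ?orbT.
Qed.

Lemma min_indep_num_del_witness (V : finType) (G : sgraph V) :
  0 < #|V| -> exists v, indep_num (del_cnbh G v) <= min_indep_num_del G.
Proof.
case/card_gt0P => v0 _; rewrite /min_indep_num_del.
apply: (big_ind (fun m => exists v, indep_num (del_cnbh G v) <= m)) => [|p q [u hu] [v hv]|v _].
- exists v0; have [J [_ _ <-]] := indep_num_del_witness G v0; exact: max_card.
- by case: (leqP p q) => _; [exists u|exists v].
- by exists v.
Qed.

(** * The exchange argument *)

(** Ordered pairs, so each conflicting edge is counted twice. *)
Definition conflicts (V T : finType) (G : sgraph V) (B : sgraph T) (f : V -> T) :=
  [set p : V * V | G p.1 p.2 && B (f p.1) (f p.2)].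

(** Suppose that the edge xy of G lies on an edge of B, and move x to the position
    p, whose occupant z (if any) goes to the old place of x.  A new conflict
    would have to involve x at p, excluded by [p_nbr], or z at the old place
    of x, excluded by [p_occ].  The condition [p != f y] keeps x and y from
    merely trading places, which would preserve their conflict. *)
Section Swap.
Variables (V T : finType) (G : sgraph V) (B : sgraph T).
Variables (f : V -> T) (x y : V) (p : T).
Hypotheses (f_inj : injective f) (xy : G x y) (fxy : B (f x) (f y)).
Hypotheses (p_y : p != f y) (p_nbr : forall u, G x u -> ~~ B (f u) p).
Hypothesis (p_occ : forall z u, f z = p -> G z u -> ~~ B (f x) (f u)).

Lemma swap_conflicts : conflicts G B (tperm (f x) p \o f) \proper conflicts G B f.
Proof.
apply/properP; split; last first.
  exists (x, y); first by rewrite inE /= xy fxy.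
  have fxNy : f x != f y by apply: contraTneq fxy => ->; rewrite adj_irr.
  rewrite inE /= xy /= tpermL tpermD //.
  by rewrite adj_sym p_nbr.
apply/subsetP => -[u v]; rewrite !inE /= => /andP[uv]; rewrite uv /=.
have vu : G v u by rewrite adj_sym.
have [ux|ux] := eqVneq u x; have [vx|vx] := eqVneq v x.
- by rewrite ux vx adj_irr in uv.
- subst u; rewrite tpermL; have [fv|fv] := eqVneq (f v) p.
    by rewrite fv tpermR adj_sym.
  rewrite tpermD; [|by rewrite eq_sym (inj_eq f_inj)|by rewrite eq_sym].
  by rewrite adj_sym (negbTE (p_nbr uv)).
- subst v; rewrite tpermL; have [fu|fu] := eqVneq (f u) p.
    by rewrite fu tpermR adj_sym.
  rewrite tpermD; [|by rewrite eq_sym (inj_eq f_inj)|by rewrite eq_sym].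
  by rewrite (negbTE (p_nbr vu)).
- have tD z : z != x -> f z != p -> tperm (f x) p (f z) = f z.
    by move=> zx zp; rewrite tpermD // eq_sym // (inj_eq f_inj).
  have [fu|fu] := eqVneq (f u) p; have [fv|fv] := eqVneq (f v) p.
  + by rewrite fu fv adj_irr.
  + by rewrite fu tpermR tD // (negbTE (p_occ fu uv)).
  + by rewrite fv tpermR tD // adj_sym (negbTE (p_occ fv vu)).
  + by rewrite !tD.
Qed.
End Swap.

(** [K] is pinned, [P] is the set of positions available to all other vertices,
    and [H] contains the vertices whose degree is not bounded.  Since no
    position in [P] is blue-adjacent to a place of [H], large degrees never
    enter the count of forbidden targets for a swap: at most d D positions are
    blue-adjacent to a place of a neighbour of x, and at most d D are occupied
    by a vertex with a neighbour placed in the blue neighbourhood of f x.  With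
    the place of y this leaves a target in [P].  The hypotheses on [f0] are
    stable under such a swap, whence an induction on the number of conflicts. *)
Lemma embedding_of_pinned (V T : finType) (G : sgraph V) (B : sgraph T) (K H : {set V})
    (P : {set T}) (d D : nat) (f0 : V -> T) :
    injective f0 -> H \subset K ->
    (forall x, (f0 x \in P) = (x \notin K)) ->
    {in K &, forall x y, G x y -> ~~ B (f0 x) (f0 y)} ->
    {in H & P, forall h p, ~~ B (f0 h) p} ->
    (forall x, x \notin H -> #|nbh G x| <= d) ->
    (forall p, #|nbh B p| <= D) ->
    (d * D).*2.+1 < #|P| ->
  exists2 f : V -> T, injective f & forall x y, G x y -> ~~ B (f x) (f y).
Proof.
have [m] := ubnP #|conflicts G B f0|.
elim: m f0 => // m IHm f le_m f_inj sHK fP fK fH degG degB big.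
have [c0|] := set_0Vmem (conflicts G B f).
  exists f => // x y xy; apply/negP => fxy.
  by have := in_set0 (x, y); rewrite -c0 inE /= xy fxy.
case=> -[x0 y0]; rewrite inE /= => /andP[xy0 fxy0].
have [x [y [xy fxy xK]]] : exists x y, [/\ G x y, B (f x) (f y) & x \notin K].
  (* Pinned vertices do not conflict, so one end of the edge is movable. *)
  have [x0K|x0K] := boolP (x0 \in K); last by exists x0, y0.
  exists y0, x0; split; rewrite 1?adj_sym //.
  by apply: contraL fxy0 => y0K; apply: fK.
have fxP : f x \in P by rewrite fP.
(* Targets that violate [p_nbr] of [swap_conflicts], respectively [p_occ]. *)
pose bad1 := \bigcup_(u in nbh G x :\: H) nbh B (f u).
pose near := f @^-1: nbh B (f x).
pose bad2 := \bigcup_(u in near) (f @: nbh G u).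
have nearH u : u \in near -> u \notin H.
  by rewrite !inE adj_sym => ufx; apply: contraL ufx => uH; apply: fH.
have hbad1 : #|bad1| <= d * D.
  apply: leq_trans (card_bigcup_le (m := D) _) _ => [u _|]; first exact: degB.
  rewrite leq_mul2r; apply/orP; right.
  apply: leq_trans (subset_leq_card (subsetDl _ _)) (degG _ _).
  by apply: contra xK; apply: (subsetP sHK).
have hbad2 : #|bad2| <= d * D.
  apply: leq_trans (card_bigcup_le (m := d) _) _ => [u /nearH uH|].
    exact: leq_trans (leq_imset_card _ _) (degG u uH).
  rewrite mulnC leq_mul2l; apply/orP; right.
  apply: leq_trans (degB (f x)); rewrite -(card_imset _ f_inj).
  by apply/subset_leq_card/subsetP => _ /imsetP[u u_near ->]; rewrite !inE in u_near *.
have [p pP pgood] : exists2 p, p \in P & p \notin (f y |: (bad1 :|: bad2)).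
  apply/subsetPn; apply: contraTN big => /subset_leq_card le_P.
  rewrite -leqNgt (leq_trans le_P) // cardsU1 -addnn -add1n leq_add ?leq_b1 //.
  exact: leq_trans (leq_card_setU _ _) (leq_add _ _).
move: pgood; rewrite !inE !negb_or => /and3P[p_y p1 p2].
have p_nbr u : G x u -> ~~ B (f u) p.
  move=> xu; have [uH|uH] := boolP (u \in H); first exact: fH.
  by apply: contra p1 => fup; apply/bigcupP; exists u; rewrite !inE ?uH.
have p_occ z u : f z = p -> G z u -> ~~ B (f x) (f u).
  move=> fz zu; apply: contra p2 => fxu; apply/bigcupP; exists u.
    by rewrite !inE.
  by apply/imsetP; exists z; rewrite // inE adj_sym.
have fx1 z : z \in K -> tperm (f x) p (f z) = f z.
  move=> zK; have : f z \notin P by rewrite fP zK.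
  by move=> zP; rewrite tpermD //; apply: contraNneq zP => <-.
apply: (IHm (tperm (f x) p \o f)) => //.
- by rewrite -ltnS (leq_trans _ le_m) // ltnS proper_card // (@swap_conflicts _ _ _ _ _ _ y).
- by apply: inj_comp => //; apply: perm_inj.
- move=> z /=; rewrite -fP; case: tpermP => [->|->|//]; by rewrite ?fxP ?pP.
- by move=> u v uK vK uv /=; rewrite !fx1 //; apply: fK.
- by move=> h q hH qP /=; rewrite fx1 ?(subsetP sHK) //; apply: fH.
Qed.

(** * Transversals and spread-out positions *)

Lemma subset_of_card (T : finType) (A : {set T}) m :
  m <= #|A| -> exists2 A' : {set T}, A' \subset A & #|A'| = m.
Proof.
case/card_geqP => s [s_uniq s_size sA]; exists [set x in s].
  by apply/subsetP => x; rewrite inE; apply: sA.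
by rewrite cardsE -s_size; apply/card_uniqP.
Qed.

(** Choosing values one position at a time, at most [#|D| - 1] are already taken. *)
Lemma greedy_transversal (T V : finType) (D : {set T}) (A : T -> {set V}) (v0 : V) :
    {in D, forall p, #|D| <= #|A p|} ->
  exists2 q : T -> V, {in D &, injective q} & {in D, forall p, q p \in A p}.
Proof.
have [m] := ubnP #|D|; elim: m D => // m IHm D le_m hA.
have [->|[p pD]] := set_0Vmem D; first by exists (fun=> v0) => p; rewrite inE.
have cD := cardsD1 p D; rewrite pD in cD.
have [|r rD|q q_inj qA] := IHm (D :\ p); first by rewrite cD in le_m.
  by rewrite (leq_trans _ (hA r _)) ?cD //; move: rD; rewrite !inE => /andP[].
have [x xA xq] : exists2 x, x \in A p & x \notin q @: (D :\ p).
  apply/subsetPn; apply: contraL (hA _ pD) => /subset_leq_card le_A.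
  by rewrite -ltnNge (leq_ltn_trans le_A) // (leq_ltn_trans (leq_imset_card _ _)) // cD.
have xqr r : r \in D -> r != p -> x != q r.
  move=> rD rp; apply: contraNneq xq => ->; apply: imset_f; by rewrite !inE rp.
exists (fun r => if r == p then x else q r) => [r s rD sD|r rD].
  case: eqVneq => [->|rp]; case: eqVneq => [->|sp] // e.
  - by case/eqP: (xqr s sD sp).
  - by case/eqP: (xqr r rD rp).
  - by apply: q_inj => //; rewrite !inE ?rp ?sp.
by case: eqVneq => [->|rp] //; apply: qA; rewrite !inE rp.
Qed.

(** Greedy: the vertices at distance at most 2 from a given one number at most
    (D + 1)^2. *)
Lemma spread_set (T : finType) (B : sgraph T) (D t : nat) :
    (forall p, #|nbh B p| <= D) -> t * D.+1 ^ 2 <= #|T| ->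
  exists2 W : {set T}, #|W| = t
    & {in W &, forall w w', w != w' -> [disjoint cnbh B w & cnbh B w']}.
Proof.
move=> degB; have degC p : #|cnbh B p| <= D.+1.
  by rewrite cardsU1 -add1n leq_add ?leq_b1 // degB.
have cnbh_sym p r : (p \in cnbh B r) = (r \in cnbh B p).
  by rewrite !inE eq_sym adj_sym.
elim: t => [|t IHt] le_T; first by exists set0; rewrite ?cards0 // => w; rewrite inE.
have lt_T : t * D.+1 ^ 2 < #|T|.
  by apply: leq_trans le_T; rewrite mulSn -[X in X < _]add0n ltn_add2r expn_gt0.
have [W cW hW] := IHt (ltnW lt_T).
pose bad := \bigcup_(w in W) \bigcup_(z in cnbh B w) cnbh B z.
have [p _ pbad] : exists2 p, p \in [set: T] & p \notin bad.
  apply/subsetPn; apply: contraTN lt_T => /subset_leq_card; rewrite cardsT => le_bad.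
  rewrite -leqNgt (leq_trans le_bad) // -cW card_bigcup_le // => w _.
  apply: leq_trans (card_bigcup_le (m := D.+1) _) _ => [z _|]; first exact: degC.
  by rewrite -mulnn leq_mul2r degC.
have far w : w \in W -> [disjoint cnbh B p & cnbh B w].
  move=> wW; rewrite disjoint_subset; apply/subsetP => z pz; rewrite inE.
  apply: contra pbad => wz; apply/bigcupP; exists w => //; apply/bigcupP; exists z => //.
  by rewrite cnbh_sym.
have pW : p \notin W.
  apply: contra pbad => pW; apply/bigcupP; exists p => //.
  by apply/bigcupP; exists p; rewrite !inE eqxx.
exists (p |: W); first by rewrite cardsU1 pW cW.
move=> w w'; rewrite !in_setU1 => /orP[/eqP->|wW] /orP[/eqP->|w'W] ww'.
- by rewrite eqxx in ww'.
- exact: far.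
- by rewrite disjoint_sym far.
- exact: hW.
Qed.

(** The pinned part is given as a partial injection [Q] from positions to vertices,
    since it is positions that have to be filled; the embedding inverts [Q] on
    [X] and sends the other vertices anywhere into [P]. *)
Lemma extend_injection (V T : finType) (X P : {set T}) (Q : T -> V) (t0 : T) :
    {in X &, injective Q} -> [disjoint X & P] -> #|V| - #|X| <= #|P| ->
  exists f : V -> T, [/\ injective f, {in X, forall p, f (Q p) = p}
    & forall x, (f x \in P) = (x \notin Q @: X)].
Proof.
move=> Qinj dXP le_P; pose K := Q @: X.
have [|g g_inj gP] := @greedy_transversal V T (~: K) (fun=> P) t0.
  by move=> x _; rewrite cardsCs setCK card_in_imset.
pose inv x := odflt t0 [pick p in X | Q p == x].
have invQ p : p \in X -> inv (Q p) = p.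
  move=> pX; rewrite /inv; case: pickP => [r /andP[rX /eqP]|/(_ p)]; last by rewrite pX eqxx.
  exact: Qinj.
have XNP p : p \in X -> p \notin P.
  by move=> pX; rewrite (disjointFr dXP).
pose f x := if x \in K then inv x else g x.
have fQ : {in X, forall p, f (Q p) = p}.
  by move=> p pX; rewrite /f imset_f // invQ.
have fP x : (f x \in P) = (x \notin K).
  rewrite /f; case: ifP => [/imsetP[p pX ->]|xK]; first by rewrite invQ // (negbTE (XNP p pX)).
  by rewrite gP // inE xK.
exists f; split=> // x y fxy.
have [xK|xK] := boolP (x \in K); have [yK|yK] := boolP (y \in K).
- by move: xK yK fxy => /imsetP[p pX ->] /imsetP[r rX ->]; rewrite !fQ // => ->.
- by have := fP y; rewrite -fxy fP xK yK.
- by have := fP x; rewrite fxy fP xK yK.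
- by move: fxy; rewrite /f (negbTE xK) (negbTE yK); apply: g_inj; rewrite inE.
Qed.

(** * Placing the vertices of large degree *)

(** The number of free positions exceeds the number of targets forbidden in the
    exchange argument. *)
Lemma free_room t D d n P : d * (2 * D.+1) < n -> t * D.+1 ^ 2 + 1 < n ->
  n - t * D.+1 <= P -> (d * D).*2.+1 < P.
Proof.
move=> hd ht hP; apply: leq_trans hP; rewrite ltn_subRL ltnNge; apply/negP => le_n.
have : n * D.+1 <= (t * D.+1 + (d * D).*2.+1) * D.+1 by rewrite leq_mul2r le_n orbT.
have : (d * (2 * D.+1)).+1 * D <= n * D by rewrite leq_mul2r hd orbT.
rewrite -muln2; nia.
Qed.

(** [W] is the set of places of [H], [N] the set of their blue neighbours, and [D']
    the part of [N] that gets filled, as large as the supply of [m] vertices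
    permits; the bound on [#|H| * D] says that the rest of [N] can stay empty.
    Each position in [N] has exactly one blue neighbour in [W], so it only has
    to avoid the neighbours of one vertex of [H], and at least [m] candidates
    in [J] remain for it. *)
Lemma embedding_of_fillers (V T : finType) (G : sgraph V) (B : sgraph T)
    (D m : nat) (H J : {set V}) :
    #|V| <= #|T| -> (forall p, #|nbh B p| <= D) ->
    (forall x, x \notin H -> #|nbh G x| * (2 * D.+1) < #|V|) ->
    #|H| * D.+1 ^ 2 + 1 < #|V| ->
    independent G J -> [disjoint H & J] ->
    #|H| * D <= m + (#|T| - #|V|) ->
    {in H, forall h, m <= #|J :\: nbh G h|} ->
  exists2 f : V -> T, injective f & forall x y, G x y -> ~~ B (f x) (f y).
Proof.
move=> leVT degB degG hH /independentP Jind dHJ hm hJ.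
have V0 : 0 < #|V| by apply: leq_ltn_trans hH.
have [v0 _] : exists v0, v0 \in V by apply/card_gt0P.
have [t0 _] : exists t0, t0 \in T by apply/card_gt0P/(leq_trans V0).
have [|W cW hW] := @spread_set T B D #|H| degB; first by lia.
have W_far w w' p : w \in W -> w' \in W -> p \in cnbh B w -> p \in cnbh B w' -> w = w'.
  move=> wW w'W pw pw'; apply: contraTeq pw' => ww'.
  by rewrite (disjointFr (hW w w' wW w'W ww')).
pose N := \bigcup_(w in W) nbh B w.
have cN : #|N| <= #|H| * D by rewrite -cW card_bigcup_le.
have WN w : w \in W -> w \notin N.
  move=> wW; apply/bigcupP => -[w' w'W]; rewrite inE => w'w.
  suff e : w = w' by rewrite e adj_irr in w'w.
  by apply: (@W_far w w' w) => //; rewrite !inE ?eqxx // w'w orbT.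
have dWN : [disjoint W & N] by rewrite disjoint_subset; apply/subsetP.
have [D' sD' cD'] := subset_of_card (geq_minr m #|N|).
have [|g g_inj gH] := @greedy_transversal T V W (fun=> H) v0; first by rewrite cW.
have gW : g @: W = H.
  apply/eqP; rewrite eqEcard card_in_imset // cW leqnn andbT.
  by apply/subsetP => _ /imsetP[w wW ->]; apply: gH.
pose A p := [set x in J | [forall w in W, B w p ==> ~~ G (g w) x]].
have [|q q_inj qA] := @greedy_transversal T V D' A v0.
  move=> p /(subsetP sD')/bigcupP[w wW]; rewrite inE => wp.
  rewrite cD' (leq_trans (geq_minl _ _)) // (leq_trans (hJ _ (gH w wW))) //.
  apply/subset_leq_card/subsetP => x; rewrite !inE => /andP[wx ->] /=.
  apply/forall_inP => w' w'W; apply/implyP => w'p.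
  by rewrite -(W_far w w' p) // !inE ?wp ?w'p orbT.
have qJ p : p \in D' -> q p \in J by move/qA; rewrite inE => /andP[].
have gq w p : w \in W -> p \in D' -> B w p -> ~~ G (g w) (q p).
  move=> wW /qA; rewrite inE => /andP[_ /forall_inP/(_ w wW)/implyP]; exact.
pose X := W :|: D'; pose P := ~: (W :|: N).
pose Q p := if p \in W then g p else q p.
have D'W p : p \in D' -> p \in W = false.
  by move=> /(subsetP sD') pN; rewrite (disjointFl dWN).
have Qg w : w \in W -> Q w = g w by rewrite /Q => ->.
have Qq p : p \in D' -> Q p = q p by rewrite /Q => /D'W ->.
have gNq w p : w \in W -> p \in D' -> g w != q p.
  move=> wW pD; apply: contraTneq (gH w wW) => ->.
  by rewrite (disjointFl dHJ (qJ p pD)).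
have Q_inj : {in X &, injective Q}.
  move=> p r /setUP[pW|pD] /setUP[rW|rD].
  - by rewrite !Qg //; apply: g_inj.
  - by rewrite Qg // Qq // => /eqP; rewrite (negbTE (gNq _ _ pW rD)).
  - by rewrite Qq // Qg // => /esym/eqP; rewrite (negbTE (gNq _ _ rW pD)).
  - by rewrite !Qq //; apply: q_inj.
have cU : #|W :|: N| = #|H| + #|N| by rewrite cardsU (disjoint_setI0 dWN) cards0 subn0 cW.
have cX : #|X| = #|H| + minn m #|N|.
  rewrite cardsU cD' cW (_ : W :&: D' = set0) ?cards0 ?subn0 //.
  apply/disjoint_setI0; rewrite disjoint_sym disjoint_subset.
  by apply/subsetP => p /D'W; rewrite inE => ->.
have cP : #|P| = #|T| - (#|H| + #|N|) by rewrite cardsCs setCK cU.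
have [||f [f_inj fQ fP]] := @extend_injection V T X P Q t0 Q_inj.
- by rewrite disjoint_sym disjoints_subset setCS; apply: setUS.
- by rewrite cX cP; lia.
apply: (@embedding_of_pinned V T G B (Q @: X) H P ((#|V|.-1) %/ (2 * D.+1)) D f) => //.
- by rewrite -gW; apply/subsetP => _ /imsetP[w wW ->]; rewrite -Qg // imset_f // inE wW.
- move=> _ _ /imsetP[p pX ->] /imsetP[r rX ->]; rewrite !fQ //; apply: contraL.
  have WW w w' : w \in W -> w' \in W -> ~~ B w w'.
    by move=> wW w'W; apply: contra (WN w' w'W) => ?; apply/bigcupP; exists w; rewrite ?inE.
  case/setUP: pX => [pW|pD]; case/setUP: rX => [rW|rD] => pr.
  + by rewrite (negbTE (WW _ _ pW rW)) in pr.
  + by rewrite Qg // Qq // gq.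
  + by rewrite Qq // Qg // adj_sym gq // adj_sym.
  + by rewrite !Qq // Jind ?qJ.
- move=> h p; rewrite -gW => /imsetP[w wW ->]; rewrite -Qg // fQ ?inE ?wW // negb_or.
  by case/andP=> _; apply: contra => wp; apply/bigcupP; exists w; rewrite ?inE.
- move=> x xH; rewrite leq_divRL //; have := degG x xH; lia.
- apply: (@free_room #|H| D _ #|V|) => //.
  + by rewrite (leq_ltn_trans (leq_divM _ _)) // prednK.
  + by rewrite cP mulnS; lia.
Qed.

(** * Numerical estimates *)

Lemma edges_bound_nat k n e : 0 < k ->
    (e%:R <= n%:R * (1 + 1 / (24%:R * k%:R - 12%:R)) :> rat)%R ->
  (24 * k - 12) * e <= n * (24 * k - 12).+1.
Proof.
move=> k0; have d0 : 0 < 24 * k - 12 by lia.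
rewrite -GRing.natrM -GRing.natrB; last by lia.
set d := 24 * k - 12 in d0 *.
have d0' : (0 < d%:R :> rat)%R by rewrite Num.Theory.ltr0n.
rewrite -(Num.Theory.ler_pM2r d0') -GRing.mulrA GRing.mulrDl !GRing.mul1r.
rewrite GRing.mulVf ?Num.Theory.lt0r_neq0 // GRing.natr1.
by rewrite -!GRing.natrM Num.Theory.ler_nat mulnC.
Qed.

(** If e >= n, the hypothesis bounds the excess e - n by n / d, hence by n / c. *)
Lemma excess_le c d n e : c <= d -> d * e <= n * d.+1 -> c * e <= n * c.+1.
Proof.
move=> cd; have [en _|/ltnW/subnKC <-] := leqP e n.
  by rewrite mulnS (leq_trans _ (leq_addl _ _)) // mulnC leq_mul2r en orbT.
rewrite !mulnDr !mulnS ![n * _]mulnC addnC leq_add2r addnC leq_add2r.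
by apply: leq_trans; rewrite leq_mul2r cd orbT.
Qed.

(** [t] vertices of degree at least n / 2k have degree sum [S] at most
    2e <= 13n/6, whence t <= 13k/3. *)
Lemma high_count_bound k n e t S : 0 < k -> 6 * k ^ 3 <= n ->
    (24 * k - 12) * e <= n * (24 * k - 12).+1 -> S <= 2 * e -> t * n <= S * (2 * k) ->
  t * k ^ 2 + 1 < n.
Proof.
move=> k0 hn he hS ht.
have n0 : 0 < n by apply: leq_trans hn; rewrite muln_gt0 expn_gt0 k0.
have {he} he : 12 * e <= n * 13 by apply: excess_le he; lia.
have ht' : 12 * t <= 52 * k.
  rewrite -(leq_pmul2r n0) -mulnA; apply: (@leq_trans (12 * (2 * e * (2 * k)))).
    by rewrite leq_mul2l /= (leq_trans ht) // leq_mul2r hS orbT.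
  have : 4 * k * (12 * e) <= 4 * k * (n * 13) by rewrite leq_mul2l he orbT.
  by lia.
have : 12 * t * k ^ 2 <= 52 * k * k ^ 2 by rewrite leq_mul2r ht' orbT.
have : 0 < k ^ 3 by rewrite expn_gt0 k0.
rewrite -mulnA -(mulnA 52) -expnS; lia.
Qed.

(** [S] is the degree sum of the vertices of [H] other than one chosen h, and [L]
    counts the leaves not adjacent to h.  For k >= 2 the edge bound gives
    4k(e - n) <= 2n/9, and the claim follows from
    (t - 1) n - 2n/9 >= 7tn/18 >= 7tk^3/3 > 2kt(k + 1). *)
Lemma leaf_supply_bound k n e t S L : 0 < k -> 6 * k ^ 3 <= n ->
    (24 * k - 12) * e <= n * (24 * k - 12).+1 -> t != 1 ->
    S + 2 * n <= 2 * e + L + 2 * t -> (t - 1) * n <= S * (2 * k) ->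
  t * k.-1 <= L.
Proof.
case: t => [|[|t]] //; case: k => [//|[|k]] _ //; first by rewrite muln0.
move=> hn he _ hL hS; rewrite leqNgt; apply/negP => ltL.
have {he} he : 18 * k.+2 * e <= n * (18 * k.+2).+1 by apply: excess_le he; lia.
have h1 : 36 * k.+2 * (S + 2 * n) <= 36 * k.+2 * (2 * e + L + 2 * t.+2).
  by rewrite leq_mul2l hL orbT.
have h3 : 36 * k.+2 * L <= 36 * k.+2 * (t.+2 * k.+1) by rewrite leq_mul2l ltnW ?orbT.
(* Here two vertices of large degree are needed: 18 (t - 1) - 4 >= 7 t is t >= 2. *)
have h4 : n * (7 * t.+2) <= n * (18 * (t.+2 - 1) - 4) by rewrite leq_mul2l; lia.
have h6 : 6 * k.+2 ^ 3 * (7 * t.+2) <= 36 * k.+2 * (k.+1 + 2) * t.+2.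
  apply: (@leq_trans (n * (7 * t.+2))); first by rewrite leq_mul2r hn orbT.
  apply: leq_trans h4 _; lia.
have h7 : 42 * k.+2 ^ 3 <= 36 * k.+2 * (k.+1 + 2).
  by rewrite -(@leq_pmul2r t.+2) //; lia.
have h8 : 42 * k.+2 ^ 2 <= 36 * (k.+1 + 2).
  by rewrite -(@leq_pmul2r k.+2) // -mulnA -expnSr; lia.
have : k.+2 * 2 <= k.+2 ^ 2 by rewrite -mulnn leq_mul2l.
lia.
Qed.

(** * Upper bound *)

Lemma star_subgraph (k : nat) (T : finType) (B : sgraph T) p :
  k <= #|nbh B p| -> subgraph (star k) B.
Proof.
rewrite cardE => hk; pose s := p :: enum (nbh B p).
have s_uniq : uniq s by rewrite /= mem_enum inE adj_irr enum_uniq.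
have lt_s (i : 'I_k.+1) : i < size s by rewrite (leq_trans (ltn_ord i)).
have nb (i : 'I_k.+1) : i != ord0 -> B p (nth p s i).
  case: i => -[|i] //= lt_i _; have : nth p (enum (nbh B p)) i \in enum (nbh B p).
    by rewrite mem_nth // (leq_trans _ hk).
  by rewrite mem_enum inE.
exists (fun i : 'I_k.+1 => nth p s i) => [i j /eqP|i j].
  by rewrite nth_uniq // => /eqP/val_inj.
rewrite /= /star_rel; case: (eqVneq i ord0) => [->|i0]; case: (eqVneq j ord0) => [->|j0] //= _.
  exact: (nb j).
by rewrite adj_sym; apply: (nb i).
Qed.

(** The two choices of the independent set of fillers: a maximum independent set
    of G_v when v is the only vertex of large degree, and the leaves otherwise. *)
Lemma ramsey_upper k n N (V : finType) (G : sgraph V) :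
    0 < k -> 6 * k ^ 3 <= n -> #|V| = n -> connected G ->
    (24 * k - 12) * #|edges G| <= n * (24 * k - 12).+1 ->
    n <= N -> n + k - 1 - min_indep_num_del G <= N ->
  ramsey_prop G (star k) N.
Proof.
move=> k0 hn hV cG he leN leaN F.
have [/existsP[p kp]|/existsPn degB] := boolP [exists p, k <= #|nbh (compl F) p|].
  by right; apply: star_subgraph kp.
left; suff [f f_inj hf] : exists2 f : V -> 'I_N,
    injective f & forall x y, G x y -> ~~ compl F (f x) (f y).
  exists f => // x y xy; have := hf x y xy; rewrite /= /compl_rel negb_and negbK.
  case/orP => [/eqP/f_inj xy'|/negPn//]; by rewrite xy' adj_irr in xy.
have n6 : 6 <= n by apply: leq_trans hn; rewrite -[X in X <= _]muln1 leq_mul2l expn_gt0 k0.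
pose H := [set x | n <= #|nbh G x| * (2 * k)].
pose t := #|H|; pose S := \sum_(h in H) #|nbh G h|.
have leS : S <= 2 * #|edges G|.
  by rewrite -sum_deg [X in _ <= X](bigID (mem H)) /= leq_addr.
have highS (A : {set V}) : A \subset H -> #|A| * n <= (\sum_(h in A) #|nbh G h|) * (2 * k).
  move=> sAH; rewrite -sum_nat_const big_distrl /=; apply: leq_sum => h hA.
  by have := subsetP sAH h hA; rewrite inE.
have few : t * k ^ 2 + 1 < n by apply: high_count_bound he leS (highS H _).
have deg_high h : h \in H -> 2 < #|nbh G h|.
  rewrite inE => hH; have le3 : 6 * k ^ 3 <= #|nbh G h| * (2 * k) := leq_trans hn hH.
  have : 3 * k ^ 2 <= #|nbh G h| by rewrite -(@leq_pmul2r (2 * k)) ?muln_gt0 //; lia.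
  by apply: leq_trans; rewrite -[X in X <= _]muln1 leq_mul2l expn_gt0 k0.
have core m (J : {set V}) : independent G J -> [disjoint H & J] ->
    t * k.-1 <= m + (N - n) -> {in H, forall h, m <= #|J :\: nbh G h|} ->
    exists2 f : V -> 'I_N, injective f & forall x y, G x y -> ~~ compl F (f x) (f y).
  move=> Jind dHJ hm hJ.
  apply: (@embedding_of_fillers V 'I_N G (compl F) k.-1 m H J);
    rewrite ?prednK ?card_ord ?hV //.
  - by move=> p; have := degB p; lia.
  - by move=> x; rewrite inE -ltnNge.
have [/cards1P[v Hv]|t1] := boolP (t == 1).
  have [J [sJ Jind cJ]] := indep_num_del_witness G v.
  apply: (core #|J| J) => //.
  - rewrite Hv disjoints1; apply: contraTN isT => /(subsetP sJ).
    by rewrite !inE eqxx.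
  - have := min_indep_num_del_le G v; rewrite /t Hv cards1 cJ; lia.
  - move=> h; rewrite Hv => /set1P ->; apply/subset_leq_card/subsetP => x xJ.
    rewrite !inE xJ andbT; have := subsetP sJ x xJ; rewrite !inE negb_or; by case/andP.
apply: (core (t * k.-1) (leaves G)); rewrite ?leq_addr //.
- by apply: independent_leaves; rewrite ?hV // (leq_trans _ n6).
- rewrite disjoint_subset; apply/subsetP => h /deg_high; rewrite !inE; by case: eqP => [->|].
move=> h hH.
have V2 : 1 < #|V| by rewrite hV (leq_trans _ n6).
have := card_leaves cG V2 (fun h hH => ltnW (deg_high h hH)).
rewrite hV (big_setD1 h hH) /= -/t => hL.
have tH : #|H :\ h| = t - 1 by rewrite /t (cardsD1 h H) hH add1n subn1.
have := highS (H :\ h) (subsetDl _ _); rewrite tH => hS.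
have cI : #|leaves G :&: nbh G h| <= #|nbh G h| by rewrite subset_leq_card ?subsetIr.
have cL := cardsID (nbh G h) (leaves G).
apply: (leaf_supply_bound k0 hn he t1 _ hS).
rewrite -(leq_add2l #|nbh G h|) addnA (leq_trans hL) //.
have arith x i r y d : i <= d -> x + (i + r) + y <= d + (x + r + y) by lia.
by rewrite -cL arith.
Qed.

(** * Lower bound *)

Lemma ramsey_prop_mono (V W : finType) (G : sgraph V) (H : sgraph W) M N :
  M <= N -> ramsey_prop G H M -> ramsey_prop G H N.
Proof.
move=> leMN hM F; pose i := widen_ord leMN.
have i_inj : injective i by move=> x y /(congr1 val)/= /val_inj.
pose F' := SGraph (fun x y => adj_sym F (i x) (i y)) (fun x => adj_irr F (i x)).
have [[f f_inj hf]|[f f_inj hf]] := hM F'; [left|right].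
  by exists (i \o f) => //; apply: inj_comp.
exists (i \o f) => [|x y xy]; first exact: inj_comp.
by have := hf x y xy; rewrite /= /compl_rel (inj_eq i_inj).
Qed.

Lemma complete_irr (T : finType) : irreflexive (fun x y : T => x != y).
Proof. by move=> x; rewrite eqxx. Qed.

Lemma complete_sym (T : finType) : symmetric (fun x y : T => x != y).
Proof. by move=> x y; rewrite eq_sym. Qed.

(** A complete red graph contains only graphs with at most as many vertices, and
    its complement contains no edge. *)
Lemma ramsey_ge_card (V : finType) (G : sgraph V) k N :
  0 < k -> ramsey_prop G (star k) N -> #|V| <= N.
Proof.
case: k => // k _ hN.
have [[f f_inj _]|[f _ hf]] := hN (SGraph (@complete_sym _) (@complete_irr _)).
  by rewrite -(card_ord N); apply: leq_card f_inj.
have /hf : star k.+1 ord0 ord_max by [].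
by rewrite /= /compl_rel /= andbN.
Qed.

(** Colouring vertices by their residue modulo [q] makes the parts as equal as
    possible, so their orders need only be bounded by [M / q]. *)
Section Multipartite.
Variables M q : nat.
Definition residue_rel : rel 'I_M := fun x y => x %% q != y %% q.
Lemma residue_sym : symmetric residue_rel.
Proof. by move=> x y; rewrite /residue_rel eq_sym. Qed.
Lemma residue_irr : irreflexive residue_rel.
Proof. by move=> x; rewrite /residue_rel eqxx. Qed.
Definition residue_graph : sgraph 'I_M := SGraph residue_sym residue_irr.
Definition residue_class c : {set 'I_M} := [set x : 'I_M | x %% q == c].

Lemma card_residue_class_le k c : M <= k * q -> #|residue_class c| <= k.
Proof.
move=> leM; have lt_k (x : 'I_M) : x %/ q < k.
  have [q0|q0] := posnP q; last by rewrite ltn_divLR // (leq_trans (ltn_ord x)).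
  by have := ltn_ord x; have := leM; rewrite q0 muln0; lia.
rewrite -[X in _ <= X]card_ord -(@card_in_imset _ _ (fun x => Ordinal (lt_k x))) ?max_card //.
move=> x y; rewrite !inE => /eqP xc /eqP yc [xy]; apply: val_inj => /=.
by rewrite (divn_eq x q) (divn_eq y q) xc yc xy.
Qed.

Lemma card_residue_class_ge l c : c < q -> l * q <= M -> l <= #|residue_class c|.
Proof.
move=> cq leM; have lt_M (i : 'I_l) : i * q + c < M.
  apply: leq_trans leM; rewrite (leq_trans (n := i.+1 * q)) ?leq_mul2r ?ltn_ord ?orbT //.
  by rewrite mulSn addnC ltn_add2r.
have i_inj : injective (fun i => Ordinal (lt_M i)).
  move=> i j [/eqP]; rewrite eqn_add2r eqn_mul2r => /orP[/eqP q0|/eqP/val_inj//].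
  by rewrite q0 in cq.
rewrite -[X in X <= _]card_ord -(card_codom i_inj); apply/subset_leq_card/subsetP => x.
by case/codomP => i ->; rewrite inE /= modnMDl modn_small.
Qed.
End Multipartite.

(** A blue star lies in one part, of order at most k.  In a red copy of G, the
    vertices placed in the part of v are pairwise non-adjacent, and at least
    [l - (M - #|V|)] of them exist. *)
Lemma multipartite_no_ramsey (V : finType) (G : sgraph V) k l q M v :
    0 < M -> l * q <= M <= k * q -> #|V| <= M ->
    M + indep_num (del_cnbh G v) + 1 < l + #|V| ->
  ~ ramsey_prop G (star k) M.
Proof.
move=> M0 /andP[lM Mk] leVM small /(_ (residue_graph M q)).
have q0 : 0 < q by case: (q) Mk => //; rewrite muln0; lia.
case=> -[f f_inj hf].
  pose C := residue_class M q (f v %% q); pose A := f @^-1: C.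
  have inA x : (x \in A) = (f x %% q == f v %% q) by rewrite !inE.
  have vA : v \in A by rewrite inA.
  have sameNadj x y : x \in A -> y \in A -> ~~ G x y.
    rewrite !inA => /eqP xv /eqP yv; apply/negP => /hf.
    by rewrite /= /residue_rel xv yv eqxx.
  have cC : l <= #|C| by apply: card_residue_class_ge => //; rewrite ltn_mod.
  have : #|C| <= #|A| + (M - #|V|).
    have -> : M - #|V| = #|~: (f @: [set: V])|.
      by rewrite cardsCs setCK card_ord card_imset // cardsT.
    rewrite -(card_imset A f_inj) (leq_trans _ (leq_card_setU _ _)) //.
    apply/subset_leq_card/subsetP => p pC; rewrite in_setU in_setC orbC -implybE.
    apply/implyP => /imsetP[x _ px]; subst p.
    by apply: imset_f; rewrite inE.
  have : #|A :\ v| <= indep_num (del_cnbh G v).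
    apply: leq_indep_num_del.
      apply/subsetP => x /setD1P[xv xA]; rewrite !inE negb_or xv /=; exact: sameNadj.
    by apply/independentP => x y /setD1P[_ xA] /setD1P[_ yA]; apply: sameNadj.
  have := cardsD1 v A; rewrite vA; lia.
have := card_residue_class_le (f ord0 %% q) Mk; rewrite leqNgt => /negP; apply.
rewrite -[X in X <= _]card_ord -cardsT -(card_imset _ f_inj).
apply/subset_leq_card/subsetP => _ /imsetP[i _ ->]; rewrite inE.
have [->//|i0] := eqVneq i ord0.
have /hf : star k ord0 i by rewrite /= /star_rel eqxx (negbTE i0).
by rewrite /= /compl_rel /= /residue_rel negbK => /andP[_ /eqP->].
Qed.

(** If k divides n + k - 2 - alpha', that many vertices split into parts of order
    k.  Otherwise M = n + k - 3 - alpha' vertices are split into M / (k - 1)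
    parts, rounded down, of order k - 1 or k; the remainder of M modulo k - 1
    can be distributed over the parts because M >= (k - 1)^2. *)
Lemma ramsey_lower k n (V : finType) (G : sgraph V) :
    let a := min_indep_num_del G in
    let beta := if k %| n + k - 2 - a then 0 else 1 in
    0 < k -> 6 * k ^ 3 <= n -> #|V| = n -> n < n + k - 1 - a - beta ->
  ~ ramsey_prop G (star k) (n + k - 1 - a - beta).-1.
Proof.
move=> a beta k0 hn hV; have k3 : k <= k ^ 3 by rewrite -[X in X <= _]expn1 leq_pexp2l.
have n0 : 0 < n by lia.
have [v hv] : exists v, indep_num (del_cnbh G v) <= a.
  by apply: min_indep_num_del_witness; rewrite hV.
rewrite /beta; case: ifP => [kM|_] lt_n.
  set M := _.-1; have eM : M = n + k - 2 - a by rewrite /M; lia.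
  rewrite -eM in kM.
  apply: (@multipartite_no_ramsey V G k k (M %/ k) M v);
    by rewrite ?hV ?(mulnC k) ?divnK ?leqnn //; lia.
set M := _.-1; have eM : M = n + k - 3 - a by rewrite /M; lia.
have k1 : 0 < k.-1 by lia.
have kk : k.-1 * k.-1 <= M.
  have : k * k <= k ^ 3 by rewrite mulnn leq_pexp2l.
  have : k.-1 * k.-1 <= k * k by rewrite leq_mul ?leq_pred.
  lia.
apply: (@multipartite_no_ramsey V G k k.-1 (M %/ k.-1) M v); rewrite ?hV //; try lia.
rewrite mulnC leq_divM /=.
have := divn_eq M k.-1; have := ltn_pmod M k1.
have : k.-1 <= M %/ k.-1 by rewrite leq_divRL.
have -> : k * (M %/ k.-1) = (M %/ k.-1) * k.-1 + M %/ k.-1.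
  by rewrite -[in LHS](prednK k0) mulSn addnC mulnC.
lia.
Qed.

(** * The Ramsey number *)

Theorem theorem4 (k n a : nat) (V : finType) (G : sgraph V)
    (hk : 1 <= k) (hn : 6 * k ^ 3 <= n)
    (hV : #|V| = n) (hconn : connected G)
    (hedges : (#|edges G|%:R <=
               n%:R * (1 + 1 / (24%:R * k%:R - 12%:R)) :> rat)%R)
    (ha : min_indep_num_del G = a) :
  let beta := if k %| n + k - 2 - a then 0 else 1 in
  exists r : nat,
    is_ramsey_number G (star k) r /\
    maxn n (n + k - 1 - a - beta) <= r <= maxn n (n + k - 1 - a).
Proof.
move=> beta.
have n0 : 0 < n by apply: leq_trans hn; rewrite muln_gt0 expn_gt0 hk.
have he := edges_bound_nat hk hedges.
set L := maxn n _; set U := maxn n _.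
have hU : ramsey_prop G (star k) U.
  by apply: (ramsey_upper hk hn hV hconn he); rewrite ?ha /U ?leq_maxl ?leq_maxr.
have hL N : ramsey_prop G (star k) N -> L <= N.
  move=> hN; have nN : n <= N by rewrite -hV; apply: ramsey_ge_card hN.
  rewrite geq_max nN /= leqNgt; apply/negP => ltN; subst a.
  apply: (ramsey_lower hk hn hV); first exact: leq_ltn_trans ltN.
  by apply: ramsey_prop_mono hN; rewrite -/beta; lia.
have L0 : 0 < L by rewrite leq_max n0.
have LU : L <= U <= L.+1 by rewrite /L /U /beta; case: ifP => _; lia.
(* The two bounds differ by at most one, so the Ramsey number is one of them. *)
have [hr|hr] := classic (ramsey_prop G (star k) L).
  exists L; split; last lia.
  by split=> // N _; apply: hL.
exists U; split; last lia.
split=> //; first lia.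
move=> N _ hN; have : L <= N := hL N hN; have : L != N by apply: contra_not_neq hr => ->.
lia.
Qed.
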